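(* Let $\Delta$ be a simplicial complex on a finite set $V$ and $N$ a commutative binoid. Every $N$-point $\rho:V\to N$ of $\Delta$ factors uniquely through $M_\Delta$; that is, there is a unique binoid homomorphism $\tilde\rho:M_\Delta\to N$ such that $\tilde\rho\circ\iota=\rho$, where $\iota:V\to M_\Delta$ is the canonical map $v\mapsto v$. In particular, $N\text{-}\mathrm{spec}\,M_\Delta\cong N\text{-}\mathrm{spec}\,\Delta$ as semibinoids, and $\operatorname{Hom}_{R\text{-alg}}(R[\Delta],R)\cong R\text{-}\mathrm{spec}\,\Delta$ for every commutative ring $R$ with identity (regarded as the binoid $(R,\cdot,1,0)$).
   Context: A commutative binoid is a commutative monoid $(M,+,0)$ with an absorbing element $\infty$ ($a+\infty=\infty$); homomorphisms are monoid homomorphisms with $\infty\mapsto\infty$. A semibinoid is a semigroup with an absorbing element; semibinoid homomorphisms preserve the operation and the absorbing element. A simplicial complex on a finite set $V$ is a collection $\Delta$ of subsets of $V$ that is closed under taking subsets and contains $\emptyset$ and all singletons $\{v\}$, $v\in V$. $M_\Delta$ is the quotient of the free commutative binoid $\mathbb N^V\cup\{\infty\}$ on $V$ obtained by identifying with $\infty$ all elements $f=\sum_vn_vv$ with $\operatorname{supp}(f)=\{v\mid n_v\ne0\}\notin\Delta$ (and nothing else). An $N$-point of $\Delta$ is a map $\rho:V\to N$ such that $\sum_{v\in A}\rho(v)=\infty$ for every $A\subseteq V$ with $A\notin\Delta$; $N\text{-}\mathrm{spec}\,\Delta$ is the set of $N$-points of $\Delta$, a semibinoid under pointwise addition with absorbing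 element $v\mapsto\infty$ ($v\in V$). $N\text{-}\mathrm{spec}\,M_\Delta$ is the set of binoid homomorphisms $M_\Delta\to N$, a semibinoid under pointwise addition with absorbing element $0\mapsto 0$, $a\mapsto\infty$ for $a\neq0$. $R[\Delta]=R[X_v\mid v\in V]/(\prod_{v\in A}X_v\mid A\subseteq V, A\notin\Delta)$ is the Stanley–Reisner algebra. *)

(* Defs.v *)
From HB Require Import structures.
From mathcomp Require Import all_boot all_algebra.
From mathcomp Require Import generic_quotient ring_quotient.
From mathcomp Require Import finmap.
From mathcomp.classical Require Import boolp.
From mathcomp.multinomials Require Import monalg.

Set Implicit Arguments.
Unset Strict Implicit.
Unset Printing Implicit Defensive.

Import GRing.Theory.

Local Open Scope ring_scope.
Local Open Scope quotient_scope.

HB.mixin Record isSemibinoid S := {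
  sbadd : S -> S -> S;
  sbinfty : S;
  sbaddA : associative sbadd;
  sbinftyl : left_zero sbinfty sbadd;
  sbinftyr : right_zero sbinfty sbadd
}.

#[short(type="semibinoidType")]
HB.structure Definition Semibinoid := {S of isSemibinoid S}.

HB.mixin Record Nmodule_isComBinoid M of GRing.Nmodule M := {
  infty : M;
  addr_infty : right_zero infty (@GRing.add M)
}.

#[short(type="comBinoidType")]
HB.structure Definition ComBinoid :=
  {M of GRing.Nmodule M & Nmodule_isComBinoid M}.

Arguments sbinfty {s}.
Arguments infty {s}.

Record semibinoid_iso (S T : semibinoidType) := SemibinoidIso {
  sbiso_fun :> S -> T;
  sbiso_add : {morph sbiso_fun : x y / sbadd x y};
  sbiso_infty : sbiso_fun sbinfty = sbinfty;
  sbiso_bij : bijective sbiso_fun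
}.

Record binoid_hom (M N : comBinoidType) := BinoidHom {
  bhom_fun :> M -> N;
  bhom_add : {morph bhom_fun : x y / x + y};
  bhom_zero : bhom_fun 0 = 0;
  bhom_infty : bhom_fun infty = infty
}.

Lemma binoid_hom_eq (M N : comBinoidType) (f g : binoid_hom M N) :
  f =1 g -> f = g.
Proof.
case: f g => [f fD f0 fI] [g gD g0 gI] /= /funext E.
by case: _ / E gD g0 gI => gD g0 gI; congr BinoidHom; exact: Prop_irrelevance.
Qed.

Lemma addr_infl (M : comBinoidType) : left_zero (@infty M) +%R.
Proof. by move=> x; rewrite addrC addr_infty. Qed.

Lemma sum_infty (M : comBinoidType) (V : finType) (A : {set V}) (f : V -> M) v :
  v \in A -> f v = infty -> \sum_(w in A) f w = infty.
Proof. by move=> vA fv; rewrite (bigD1 v) //= fv addr_infl. Qed.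

Record simplicial_complex (V : finType) := SimplicialComplex {
  faces :> {set {set V}};
  faces_sub : forall A B : {set V}, A \subset B -> B \in faces -> A \in faces;
  faces_empty : set0 \in faces;
  faces_vertex : forall v : V, [set v] \in faces
}.

(* The free commutative binoid N^V with infinity adjoined; [None] is the
   absorbing element. *)
Definition freeBinoid (V : finType) := option {ffun V -> nat}.

Section FreeBinoid.
Variable V : finType.
Implicit Types x y : freeBinoid V.

HB.instance Definition _ := Choice.on (freeBinoid V).

Definition free_add x y : freeBinoid V :=
  if x is Some f then if y is Some g then Some (f + g) else None else None.

Let free_addA : associative free_add.
Proof. by case=> [f|] [g|] [h|] //=; rewrite addrA. Qed.
Let free_addC : commutative free_add.
Proof. by case=> [f|] [g|] //=; rewrite addrC. Qed.
Let free_add0 : left_id (Some 0 : freeBinoid V) free_add.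
Proof. by case=> [f|] //=; rewrite add0r. Qed.

HB.instance Definition _ :=
  GRing.isNmodule.Build (freeBinoid V) free_addA free_addC free_add0.

Let free_infty : right_zero (None : freeBinoid V) +%R.
Proof. by case. Qed.

HB.instance Definition _ := Nmodule_isComBinoid.Build (freeBinoid V) free_infty.

End FreeBinoid.

Definition fsupp (V : finType) (f : {ffun V -> nat}) : {set V} :=
  [set v | f v != 0%N].

Section SimplicialBinoid.
Variables (V : finType) (D : simplicial_complex V).

Definition killed (x : freeBinoid V) : bool :=
  if x is Some f then fsupp f \notin D else true.

Definition simplicial_rel (x y : freeBinoid V) : bool :=
  (x == y) || (killed x && killed y).

Fact simplicial_rel_equiv : equiv_class_of simplicial_rel.
Proof.
split=> [x|x y|y x z]; rewrite /simplicial_rel ?eqxx //.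
  by rewrite eq_sym andbC.
case: eqP => [->|_] //=; case: (y =P z) => [->|_] /=; first by move=> ->; rewrite orbT.
by case/andP=> -> _ /andP[_ ->]; rewrite orbT.
Qed.

Canonical simplicial_equiv := EquivRelPack simplicial_rel_equiv.
Canonical simplicial_encModRel := defaultEncModRel simplicial_rel.

Definition simplicialBinoid := {eq_quot simplicial_rel}.

HB.instance Definition _ : EqQuotient _ simplicial_rel simplicialBinoid :=
  EqQuotient.on simplicialBinoid.
HB.instance Definition _ := Choice.on simplicialBinoid.

Definition sb_zero : simplicialBinoid := lift_cst simplicialBinoid 0.
Definition sb_infty : simplicialBinoid := lift_cst simplicialBinoid infty.
Definition sb_add := lift_op2 simplicialBinoid +%R.

Canonical pi_sb_zero_morph := PiConst sb_zero.
Canonical pi_sb_infty_morph := PiConst sb_infty.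

Lemma fsuppD (f g : {ffun V -> nat}) : fsupp (f + g) = fsupp f :|: fsupp g.
Proof. by apply/setP=> v; rewrite !inE ffunE addn_eq0 negb_and. Qed.

Lemma killedD x y : killed x -> killed (x + y).
Proof.
case: x y => [f|] [g|] //= Hf; rewrite fsuppD; apply: contra Hf.
by apply: faces_sub; apply: subsetUl.
Qed.

Lemma simplicial_relD x x' y y' :
  simplicial_rel x x' -> simplicial_rel y y' ->
  simplicial_rel (x + y) (x' + y').
Proof.
rewrite /simplicial_rel => /orP[/eqP->|/andP[kx kx']].
  case/orP=> [/eqP->|/andP[ky ky']]; first by rewrite eqxx.
  by rewrite ![x' + _]addrC !killedD // orbT.
by move=> _; rewrite !killedD // orbT.
Qed.

Lemma pi_sb_add : {morph \pi_simplicialBinoid : x y / x + y >-> sb_add x y}.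
Proof.
move=> x y /=; unlock sb_add; apply/eqP; rewrite piE.
by apply: simplicial_relD; rewrite -[simplicial_rel _ _]/(equiv simplicial_equiv _ _)
  -eqmodE reprK.
Qed.
Canonical pi_sb_add_morph := PiMorph2 pi_sb_add.

Let sb_addA : associative sb_add.
Proof. by move=> x y z; rewrite -[x]reprK -[y]reprK -[z]reprK !piE addrA. Qed.
Let sb_addC : commutative sb_add.
Proof. by move=> x y; rewrite -[x]reprK -[y]reprK !piE addrC. Qed.
Let sb_add0 : left_id sb_zero sb_add.
Proof. by move=> x; rewrite -[x]reprK !piE add0r. Qed.

HB.instance Definition _ :=
  GRing.isNmodule.Build simplicialBinoid sb_addA sb_addC sb_add0.

Let sb_add_infty : right_zero sb_infty +%R.
Proof.
move=> x; rewrite -[x]reprK -[LHS]/(sb_add _ _) !piE.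
by rewrite addr_infty.
Qed.

HB.instance Definition _ :=
  Nmodule_isComBinoid.Build simplicialBinoid sb_add_infty.

Definition simplicial_iota (v : V) : simplicialBinoid :=
  \pi_simplicialBinoid (Some [ffun w => (w == v) : nat]).

Lemma sbM_addr_eq0 (x y : simplicialBinoid) : x + y = 0 -> x = 0.
Proof.
rewrite -[x]reprK -[y]reprK -[_ + _]/(sb_add _ _) -[0]/sb_zero !piE.
move: (repr x) (repr y) => {x y} a b /eqP; rewrite piE => H; apply/eqP; rewrite piE.
have k0 : killed 0 = false.
  by rewrite /= (_ : fsupp 0 = set0) ?faces_empty //; apply/setP=> v; rewrite !inE ffunE.
move: H; rewrite /simplicial_rel k0 !andbF !orbF.
case: a b => [f|] [g|] //= /eqP [H]; apply/eqP; congr Some; apply/ffunP=> v.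
by move/ffunP/(_ v)/eqP: H; rewrite !ffunE addn_eq0 => /andP[/eqP-> _].
Qed.

Lemma sbM_infty_neq0 : (infty : simplicialBinoid) != 0.
Proof.
rewrite -[infty]/sb_infty -[0]/sb_zero !piE /simplicial_rel /=.
by rewrite (_ : fsupp 0 = set0) ?faces_empty //; apply/setP=> v; rewrite !inE ffunE.
Qed.

End SimplicialBinoid.

Record Npoint (N : comBinoidType) (V : finType) (D : simplicial_complex V) :=
  NPoint {
    npoint_fun :> V -> N;
    npointP : forall A : {set V}, A \notin D -> \sum_(v in A) npoint_fun v = infty
  }.

Lemma Npoint_eq (N : comBinoidType) (V : finType) (D : simplicial_complex V)
    (r s : Npoint N D) : r =1 s -> r = s.
Proof.
case: r s => [r Hr] [s Hs] /= /funext E.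
by case: _ / E Hs => Hs; congr NPoint; exact: Prop_irrelevance.
Qed.

Section SpecComplex.
Variables (N : comBinoidType) (V : finType) (D : simplicial_complex V).

Fact npoint_add_subproof (r s : Npoint N D) (A : {set V}) :
  A \notin D -> \sum_(v in A) (r v + s v) = infty.
Proof. by move=> AD; rewrite big_split /= !npointP // addr_infty. Qed.

Definition npoint_add (r s : Npoint N D) : Npoint N D :=
  NPoint (npoint_add_subproof r s).

Fact npoint_infty_subproof (A : {set V}) :
  A \notin D -> \sum_(v in A) infty = infty :> N.
Proof.
move=> AD; have [A0|[v vA]] := set_0Vmem A.
  by rewrite A0 faces_empty in AD.
exact: sum_infty vA _.
Qed.

Definition npoint_infty : Npoint N D :=
  @NPoint N V D (fun=> infty) npoint_infty_subproof.

Let npoint_addA : associative npoint_add.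
Proof. by move=> r s t; apply: Npoint_eq => v /=; rewrite addrA. Qed.
Let npoint_inftyl : left_zero npoint_infty npoint_add.
Proof. by move=> r; apply: Npoint_eq => v /=; rewrite addr_infl. Qed.
Let npoint_inftyr : right_zero npoint_infty npoint_add.
Proof. by move=> r; apply: Npoint_eq => v /=; rewrite addr_infty. Qed.

HB.instance Definition _ :=
  isSemibinoid.Build (Npoint N D) npoint_addA npoint_inftyl npoint_inftyr.

End SpecComplex.

Definition specM (N : comBinoidType) (V : finType) (D : simplicial_complex V) :=
  binoid_hom (simplicialBinoid D) N.

Section SpecBinoid.
Variables (N : comBinoidType) (V : finType) (D : simplicial_complex V).
Local Notation M := (simplicialBinoid D).

Fact specM_add_add (f g : specM N D) :
  {morph (fun x => f x + g x) : x y / x + y}.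
Proof. by move=> x y; rewrite !bhom_add addrACA. Qed.
Fact specM_add_zero (f g : specM N D) : f 0 + g 0 = 0.
Proof. by rewrite !bhom_zero addr0. Qed.
Fact specM_add_infty (f g : specM N D) : f infty + g infty = infty.
Proof. by rewrite !bhom_infty addr_infty. Qed.

Definition specM_add (f g : specM N D) : specM N D :=
  @BinoidHom M N (fun x => f x + g x)
    (specM_add_add f g) (specM_add_zero f g) (specM_add_infty f g).

Definition specM_infty_fun (x : M) : N := if x == 0 then 0 else infty.

Fact specM_infty_add : {morph specM_infty_fun : x y / x + y}.
Proof.
move=> x y; rewrite /specM_infty_fun; have [->|x0] := eqVneq x 0.
  by rewrite !add0r.
case: eqP => [/sbM_addr_eq0 /eqP|_]; first by rewrite (negPf x0).
by rewrite addr_infl.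
Qed.
Fact specM_infty_zero : specM_infty_fun 0 = 0.
Proof. by rewrite /specM_infty_fun eqxx. Qed.
Fact specM_infty_infty : specM_infty_fun infty = infty.
Proof. by rewrite /specM_infty_fun (negPf (sbM_infty_neq0 D)). Qed.

Definition specM_infty : specM N D :=
  BinoidHom specM_infty_add specM_infty_zero specM_infty_infty.

Let specM_addA : associative specM_add.
Proof. by move=> f g h; apply: binoid_hom_eq => x /=; rewrite addrA. Qed.
Let specM_inftyl : left_zero specM_infty specM_add.
Proof.
move=> f; apply: binoid_hom_eq => x /=; rewrite /specM_infty_fun.
by case: eqP => [->|_]; rewrite ?bhom_zero ?addr0 ?addr_infl.
Qed.
Let specM_inftyr : right_zero specM_infty specM_add.
Proof.
move=> f; apply: binoid_hom_eq => x /=; rewrite /specM_infty_fun.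
by case: eqP => [->|_]; rewrite ?bhom_zero ?addr0 ?addr_infty.
Qed.

HB.instance Definition _ :=
  isSemibinoid.Build (specM N D) specM_addA specM_inftyl specM_inftyr.

End SpecBinoid.

(* A commutative ring R regarded as the binoid (R, *, 1, 0): in this type
   [+%R], [0] and [infty] are the product, the one and the zero of R. *)
Definition mulBinoid (R : comPzRingType) : Type := R.

Section MulBinoid.
Variable R : comPzRingType.
HB.instance Definition _ := Choice.on (mulBinoid R).
HB.instance Definition _ :=
  GRing.isNmodule.Build (mulBinoid R) (@mulrA R) (@mulrC R) (@mul1r R).
HB.instance Definition _ :=
  Nmodule_isComBinoid.Build (mulBinoid R) (@mulr0 R).
End MulBinoid.

(* The polynomial ring R[X_v | v in V]: finitely supported functions from
   exponents to R with the convolution product. The product that [malg] and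
   [mpoly] come with requires R to be nontrivial, so it is set up here for
   an arbitrary commutative ring. *)
Definition polyV (R : comPzRingType) (V : finType) : Type :=
  {malg R[{ffun V -> nat}]}.

Section PolyV.
Variables (R : comPzRingType) (V : finType).
Local Notation K := {ffun V -> nat}.
Implicit Types p q r : polyV R V.

HB.instance Definition _ := GRing.Zmodule.on (polyV R V).

Definition polyV_mul p q : polyV R V :=
  \sum_(k <- msupp p) \sum_(l <- msupp q)
    mkmalgU (k + l) (mcoeff k p * mcoeff l q).

Definition polyV_C (c : R) : polyV R V := mkmalgU 0 c.

Definition polyV_X (v : V) : polyV R V :=
  mkmalgU [ffun w => (w == v) : nat] 1.

Lemma polyV_mulw (d1 d2 : {fset K}) p q :
  (msupp p `<=` d1)%fset -> (msupp q `<=` d2)%fset ->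
  polyV_mul p q = \sum_(k <- d1) \sum_(l <- d2)
    mkmalgU (k + l) (mcoeff k p * mcoeff l q).
Proof.
move=> le1 le2; rewrite /polyV_mul (big_fset_incl _ le1) /=.
  apply/eq_bigr=> k _; apply/big_fset_incl => // l _ /mcoeff_outdom ->.
  by rewrite mulr0 monalgU0.
move=> k _ /mcoeff_outdom pk.
by rewrite big1 => // l _; rewrite pk mul0r monalgU0.
Qed.

Lemma polyV_mulC : commutative polyV_mul.
Proof.
move=> p q; rewrite /polyV_mul exchange_big /=.
by apply: eq_bigr => k _; apply: eq_bigr => l _; rewrite addrC mulrC.
Qed.

Lemma polyV_mulDl : left_distributive polyV_mul +%R.
Proof.
move=> p q r.
rewrite (polyV_mulw (msuppD_le p q) (fsubset_refl _)).
rewrite (polyV_mulw (fsubsetUl (msupp p) (msupp q)) (fsubset_refl _)).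
rewrite (polyV_mulw (fsubsetUr (msupp p) (msupp q)) (fsubset_refl _)).
rewrite -big_split /=; apply: eq_bigr => k _.
rewrite -big_split /=; apply: eq_bigr => l _.
by rewrite mcoeffD mulrDl monalgUD.
Qed.

Lemma polyV_mulUU k l (a b : R) :
  polyV_mul (mkmalgU k a) (mkmalgU l b) = mkmalgU (k + l) (a * b).
Proof. by rewrite (polyV_mulw msuppU_le msuppU_le) !big_seq_fset1 !mcoeffUU. Qed.

Lemma polyV_mul0l : left_zero 0 polyV_mul.
Proof. by move=> p; rewrite /polyV_mul msupp0 big_seq_fset0. Qed.

Lemma polyV_mul0r : right_zero 0 polyV_mul.
Proof. by move=> p; rewrite polyV_mulC polyV_mul0l. Qed.

Lemma polyV_mulDr : right_distributive polyV_mul +%R.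
Proof. by move=> p q r; rewrite polyV_mulC polyV_mulDl !(polyV_mulC _ p). Qed.

Lemma polyV_ind (P : polyV R V -> Prop) :
  P 0 -> (forall p q, P p -> P q -> P (p + q)) ->
  (forall k (c : R), P (mkmalgU k c)) -> forall p, P p.
Proof.
by move=> P0 PD PU p; rewrite [p]monalgE; apply: big_ind => // k _; apply: PU.
Qed.

Lemma polyV_mulA : associative polyV_mul.
Proof.
move=> p q r; elim/polyV_ind: p => [|p1 p2 IH1 IH2|k a].
- by rewrite !polyV_mul0l.
- by rewrite !polyV_mulDl IH1 IH2.
elim/polyV_ind: q => [|q1 q2 IH1 IH2|l b].
- by rewrite !(polyV_mul0l, polyV_mul0r).
- by rewrite !(polyV_mulDl, polyV_mulDr) IH1 IH2.
elim/polyV_ind: r => [|r1 r2 IH1 IH2|m c].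
- by rewrite !polyV_mul0r.
- by rewrite !polyV_mulDr IH1 IH2.
by rewrite !polyV_mulUU addrA mulrA.
Qed.

Lemma polyV_mul1 : left_id (polyV_C 1) polyV_mul.
Proof.
move=> p; elim/polyV_ind: p => [|p q IHp IHq|k a].
- exact: polyV_mul0r.
- by rewrite polyV_mulDr IHp IHq.
by rewrite polyV_mulUU add0r mul1r.
Qed.

HB.instance Definition _ := GRing.Zmodule_isComPzRing.Build (polyV R V)
  polyV_mulA polyV_mulC polyV_mul1 polyV_mulDl.

End PolyV.

Section StanleyReisner.
Variables (R : comPzRingType) (V : finType) (D : simplicial_complex V).
Local Notation P := (polyV R V).

(* The ideal generated by the (finitely many) monomials of the nonfaces. *)
Definition SR_ideal : {pred P} := fun p =>
  `[< exists c : {set V} -> P,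
        p = \sum_(A : {set V} | A \notin D) c A * \prod_(v in A) polyV_X R v >].

Fact SR_ideal_zmod : zmod_closed SR_ideal.
Proof.
split=> [|p q /asboolP[c ->] /asboolP[d ->]]; apply/asboolP.
  by exists (fun=> 0); rewrite big1 // => A _; rewrite mul0r.
exists (fun A => c A - d A); rewrite -sumrB.
by apply: eq_bigr => A _; rewrite mulrBl.
Qed.

Lemma SR_idealM (p q : P) : q \in SR_ideal -> p * q \in SR_ideal.
Proof.
move=> /asboolP[c ->]; apply/asboolP; exists (fun A => p * c A).
by rewrite mulr_sumr; apply: eq_bigr => A _; rewrite mulrA.
Qed.

HB.instance Definition _ := GRing.isZmodClosed.Build P SR_ideal SR_ideal_zmod.

Definition stanleyReisner : Type := Quotient.quot SR_ideal.

HB.instance Definition _ := GRing.Zmodule.on stanleyReisner.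
HB.instance Definition _ := EqQuotient.on stanleyReisner.


Definition SR_one : stanleyReisner := lift_cst stanleyReisner 1.
Definition SR_mul := lift_op2 stanleyReisner *%R.

Canonical pi_SR_one_morph := PiConst SR_one.

Lemma pi_SR_mul : {morph \pi_stanleyReisner : p q / p * q >-> SR_mul p q}.
Proof.
move=> p q /=; unlock SR_mul; apply/eqP; rewrite piE Quotient.equivE.
rewrite -[p * q](addrNK (p * repr (\pi_stanleyReisner q))) -mulrBr.
rewrite -addrA -mulrBl rpredD //.
  by rewrite SR_idealM // Quotient.idealrBE reprK.
by rewrite mulrC SR_idealM // Quotient.idealrBE reprK.
Qed.
Canonical pi_SR_mul_morph := PiMorph2 pi_SR_mul.

Let SR_mulA : associative SR_mul.
Proof. by move=> x y z; rewrite -[x]reprK -[y]reprK -[z]reprK !piE mulrA. Qed.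
Let SR_mulC : commutative SR_mul.
Proof. by move=> x y; rewrite -[x]reprK -[y]reprK !piE mulrC. Qed.
Let SR_mul1 : left_id SR_one SR_mul.
Proof. by move=> x; rewrite -[x]reprK !piE mul1r. Qed.
Let SR_mulDl : left_distributive SR_mul +%R.
Proof. by move=> x y z; rewrite -[x]reprK -[y]reprK -[z]reprK !piE mulrDl. Qed.

HB.instance Definition _ := GRing.Zmodule_isComPzRing.Build stanleyReisner
  SR_mulA SR_mulC SR_mul1 SR_mulDl.

(* The structure map of the R-algebra R[D]. *)
Definition SR_C (c : R) : stanleyReisner := \pi_stanleyReisner (polyV_C V c).

Fact SR_C_zmod : zmod_morphism SR_C.
Proof. by move=> a b; rewrite /SR_C /polyV_C monalgUB !piE. Qed.

Fact SR_C_monoid : monoid_morphism SR_C.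
Proof.
split=> [|a b]; rewrite /SR_C; first by rewrite -[RHS]/SR_one !piE.
rewrite -[RHS]/(SR_mul _ _) !piE -[polyV_C V a * _]/(polyV_mul _ _).
by rewrite polyV_mulUU addr0.
Qed.

HB.instance Definition _ := GRing.isZmodMorphism.Build R stanleyReisner
  SR_C SR_C_zmod.
HB.instance Definition _ := GRing.isMonoidMorphism.Build R stanleyReisner
  SR_C SR_C_monoid.

Definition SR_X (v : V) : stanleyReisner := \pi_stanleyReisner (polyV_X R v).

Record SR_algHom := SRAlgHom {
  SR_algHom_fun :> stanleyReisner -> R;
  SR_algHom_zmod : zmod_morphism SR_algHom_fun;
  SR_algHom_monoid : monoid_morphism SR_algHom_fun;
  SR_algHom_C : forall c, SR_algHom_fun (SR_C c) = c
}.

End StanleyReisner.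

(* Main.v *)
Require Import Defs.
From mathcomp Require Import all_boot all_algebra.
From mathcomp Require Import generic_quotient ring_quotient finmap.
From mathcomp.multinomials Require Import monalg.

(** A monoid morphism out of [N^V] is determined by its values on the unit
    vectors, and these can be prescribed freely. An [N]-point, extended in this
    way, sends every exponent whose support is a nonface to infinity, so it
    descends to [M_D]. Applied to the multiplicative binoid of [R], the same
    extension evaluates monomials; extending it linearly gives the evaluation of
    polynomials, which kills the Stanley-Reisner ideal. *)

Set Implicit Arguments.
Unset Strict Implicit.
Unset Printing Implicit Defensive.

Import GRing.Theory.

Local Open Scope ring_scope.
Local Open Scope quotient_scope.

(** * Monoid morphisms out of [N^V] *)

Section Exponents.
Variables (V : finType) (N : nmodType).

Definition exponent_unit (v : V) : {ffun V -> nat} := [ffun w => (w == v) : nat].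

Definition exponent_eval (r : V -> N) (k : {ffun V -> nat}) : N :=
  \sum_v r v *+ k v.

Lemma exponent_eval0 r : exponent_eval r 0 = 0.
Proof. by rewrite /exponent_eval big1 // => v _; rewrite ffunE. Qed.

Lemma exponent_evalD r : {morph exponent_eval r : k l / k + l}.
Proof.
move=> k l; rewrite /exponent_eval -big_split /=.
by apply: eq_bigr => v _; rewrite ffunE mulrnDr.
Qed.

Lemma exponent_eval_unit r v : exponent_eval r (exponent_unit v) = r v.
Proof.
rewrite /exponent_eval (bigD1 v) //= ffunE eqxx mulr1n big1 ?addr0 // => w wv.
by rewrite ffunE (negPf wv).
Qed.

Lemma exponent_sumE (k : {ffun V -> nat}) :
  k = \sum_v exponent_unit v *+ k v.
Proof.
apply/ffunP => w; rewrite sum_ffunE (bigD1 w) //= ffunMnE ffunE eqxx.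
rewrite big1 ?addr0 => [|v vw]; last by rewrite ffunMnE ffunE eq_sym (negPf vw) mul0rn.
by elim: (k w) => // n IH; rewrite mulrS -IH.
Qed.

(** Apply [f] to the decomposition of [k] into multiples of unit vectors. Both uniqueness claims,
    for binoid and for algebra homomorphisms, rest on this. *)
Lemma exponent_morphE (f : {ffun V -> nat} -> N) :
  f 0 = 0 -> {morph f : k l / k + l} ->
  f =1 exponent_eval (f \o exponent_unit).
Proof.
move=> f0 fD k; rewrite {1}[k]exponent_sumE (big_morph f fD f0).
apply: eq_bigr => v _ /=.
by elim: (k v) => [|n IH]; rewrite ?mulr0n // !mulrS fD IH.
Qed.

End Exponents.

(** * Points of [D] and binoid homomorphisms out of [M_D] *)

Section NpointEval.
Variables (N : comBinoidType) (V : finType) (D : simplicial_complex V).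

(** On its support [k] is at least 1, so one full copy of the sum of [r] over the support splits
    off. That copy is infinite and absorbs the rest. *)
Lemma exponent_eval_nonface (r : Npoint N D) (k : {ffun V -> nat}) :
  fsupp k \notin D -> exponent_eval r k = infty.
Proof.
move=> kD; rewrite /exponent_eval (bigID (mem (fsupp k))) /=.
have -> : \sum_(v in fsupp k) r v *+ k v
        = \sum_(v in fsupp k) r v + \sum_(v in fsupp k) r v *+ (k v).-1.
  rewrite -big_split; apply: eq_bigr => v /=.
  by rewrite inE; case: (k v) => // n _; rewrite mulrS.
by rewrite npointP // !addr_infl.
Qed.

Definition free_eval (r : Npoint N D) (x : freeBinoid V) : N :=
  if x is Some k then exponent_eval r k else infty.

Lemma free_evalD r : {morph free_eval r : x y / x + y}.
Proof.
by case=> [k|] [l|] /=; rewrite ?addr_infty ?addr_infl ?exponent_evalD.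
Qed.

Lemma free_eval_killed r x : killed D x -> free_eval r x = infty.
Proof. by case: x => //= k /exponent_eval_nonface. Qed.

Definition npoint_ext_fun (r : Npoint N D) (x : simplicialBinoid D) : N :=
  free_eval r (repr x).

(** This is independence of the representative: two representatives of a class are equal or both
    killed, and killed elements evaluate to infinity. *)
Lemma npoint_ext_pi r x :
  npoint_ext_fun r (\pi_(simplicialBinoid D) x) = free_eval r x.
Proof.
rewrite /npoint_ext_fun; case: piP => y /eqP; rewrite piE.
by case/orP => [/eqP->|/andP[kx ky]] //; rewrite !free_eval_killed.
Qed.

Lemma pi_simplicialD : {morph \pi_(simplicialBinoid D) : x y / x + y}.
Proof. exact: pi_sb_add. Qed.

Lemma pi_simplicial0 : \pi_(simplicialBinoid D) 0 = 0.
Proof. by rewrite -[RHS]/(sb_zero D) piE. Qed.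

Lemma pi_simplicial_infty : \pi_(simplicialBinoid D) infty = infty.
Proof. by rewrite -[RHS]/(sb_infty D) piE. Qed.

Lemma npoint_extD r : {morph npoint_ext_fun r : x y / x + y}.
Proof.
move=> x y; rewrite -[x]reprK -[y]reprK -pi_simplicialD !npoint_ext_pi.
exact: free_evalD.
Qed.

Lemma npoint_ext0 r : npoint_ext_fun r 0 = 0.
Proof. by rewrite -pi_simplicial0 npoint_ext_pi; exact: exponent_eval0. Qed.

Lemma npoint_ext_infty r : npoint_ext_fun r infty = infty.
Proof. by rewrite -pi_simplicial_infty npoint_ext_pi. Qed.

Definition npoint_ext (r : Npoint N D) : specM N D :=
  BinoidHom (npoint_extD r) (npoint_ext0 r) (npoint_ext_infty r).

Lemma npoint_ext_iota r : npoint_ext r \o simplicial_iota D =1 r.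
Proof. by move=> v /=; rewrite npoint_ext_pi /= exponent_eval_unit. Qed.

Lemma specM_expE (f : specM N D) k :
  f (\pi_(simplicialBinoid D) (Some k))
  = exponent_eval (f \o simplicial_iota D) k.
Proof.
pose g k := f (\pi_(simplicialBinoid D) (Some k)).
apply: (exponent_morphE (f := g)) => [|{}k l].
  by rewrite /g -[Some 0]/(0 : freeBinoid V) pi_simplicial0 bhom_zero.
by rewrite /g -bhom_add -pi_simplicialD.
Qed.

Lemma specM_inj (f g : specM N D) :
  f \o simplicial_iota D =1 g \o simplicial_iota D -> f = g.
Proof.
move=> fg; apply: binoid_hom_eq => x; rewrite -[x]reprK.
case: (repr x) => [k|]; last first.
  by rewrite -[None]/(infty : freeBinoid V) pi_simplicial_infty !bhom_infty.
by rewrite !specM_expE; apply: eq_bigr => v _; rewrite fg.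
Qed.

(** The sum is the class of the indicator vector of [A], whose support is the nonface [A]. Thus
    [simplicial_iota] is itself a point, and composing it with a homomorphism gives a point
    again. *)
Lemma simplicial_iota_nonface (A : {set V}) :
  A \notin D -> \sum_(v in A) simplicial_iota D v = infty.
Proof.
move=> AD; pose h k := \pi_(simplicialBinoid D) (Some k : freeBinoid V).
have hD : {morph h : k l / k + l} by move=> k l; rewrite /h -pi_simplicialD.
have h0 : h 0 = 0 by exact: pi_simplicial0.
transitivity (h (\sum_(v in A) exponent_unit v)).
  by rewrite (big_morph h hD h0).
rewrite -pi_simplicial_infty.
apply/eqP; rewrite piE /simplicial_rel /= andbT; apply: contra AD.
suff -> : fsupp (\sum_(v in A) exponent_unit v) = A by [].
apply/setP => w; rewrite inE sum_ffunE.
have [wA|wA] := boolP (w \in A); first by rewrite (bigD1 w) //= ffunE eqxx.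
rewrite big1 // => v vA; rewrite ffunE; case: eqP => // wv.
by rewrite wv vA in wA.
Qed.

Lemma specM_npointP (f : specM N D) (A : {set V}) :
  A \notin D -> \sum_(v in A) f (simplicial_iota D v) = infty.
Proof.
move=> AD; rewrite -(big_morph f (bhom_add f) (bhom_zero f)).
by rewrite simplicial_iota_nonface // bhom_infty.
Qed.

Definition specM_npoint (f : specM N D) : Npoint N D := NPoint (specM_npointP f).

Lemma specM_npointD : {morph specM_npoint : f g / sbadd f g}.
Proof. by move=> f g; apply: Npoint_eq. Qed.

(** Since the empty set is a face, 0 is not killed and is alone in its class. This matters because
    the absorbing homomorphism is infinite only away from 0. *)
Lemma simplicial_iota_neq0 v : simplicial_iota D v != 0.
Proof.
rewrite -pi_simplicial0 piE /simplicial_rel.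
rewrite (_ : killed D 0 = false) ?andbF ?orbF; last first.
  by rewrite /= (_ : fsupp 0 = set0) ?faces_empty //; apply/setP=> w; rewrite !inE ffunE.
by apply/eqP => -[/ffunP/(_ v)]; rewrite !ffunE eqxx.
Qed.

Lemma specM_npoint_infty : specM_npoint sbinfty = sbinfty.
Proof.
apply: Npoint_eq => v /=.
by rewrite /specM_infty_fun (negPf (simplicial_iota_neq0 v)).
Qed.

Lemma specM_npoint_bij : bijective specM_npoint.
Proof.
exists npoint_ext => [f|r]; last exact/Npoint_eq/npoint_ext_iota.
exact/specM_inj/npoint_ext_iota.
Qed.

Definition specM_npoint_iso : semibinoid_iso (specM N D) (Npoint N D) :=
  SemibinoidIso specM_npointD specM_npoint_infty specM_npoint_bij.

End NpointEval.

(** * The Stanley-Reisner algebra and its homomorphisms to [R] *)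

Section StanleyReisnerPoints.
Variables (R : comPzRingType) (V : finType) (D : simplicial_complex V).
Local Notation K := {ffun V -> nat}.
Local Notation P := (polyV R V).
Local Notation SR := (stanleyReisner R D).

Lemma pi_SR0 : \pi_SR 0 = 0.
Proof. by rewrite !piE. Qed.

Lemma pi_SRD : {morph \pi_SR : p q / p + q}.
Proof. by move=> p q; rewrite !piE. Qed.

Lemma pi_SRB : {morph \pi_SR : p q / p - q}.
Proof. by move=> p q; rewrite !piE. Qed.

Lemma pi_SRM : {morph \pi_SR : p q / p * q}.
Proof. exact: pi_SR_mul. Qed.

Lemma pi_SR1 : \pi_SR 1 = 1.
Proof. by rewrite -[RHS]/(SR_one R D) piE. Qed.

Section PolyEval.
Variable r : Npoint (mulBinoid R) D.

(** Addition in [mulBinoid R] is multiplication in [R], so this is the product of the powers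
    [r v ^+ k v]. *)
Definition monom_eval (k : K) : R := exponent_eval r k.

Lemma monom_eval0 : monom_eval 0 = 1.
Proof. exact: (exponent_eval0 r). Qed.

Lemma monom_evalD k l : monom_eval (k + l) = monom_eval k * monom_eval l.
Proof. exact: (exponent_evalD r). Qed.

Definition polyV_eval (p : P) : R :=
  \sum_(k <- msupp p) mcoeff k p * monom_eval k.

Lemma polyV_evalw (d : {fset K}) (p : P) : (msupp p `<=` d)%fset ->
  polyV_eval p = \sum_(k <- d) mcoeff k p * monom_eval k.
Proof.
move=> le; apply: big_fset_incl => // k _ /mcoeff_outdom ->.
by rewrite mul0r.
Qed.

Lemma polyV_evalD : {morph polyV_eval : p q / p + q}.
Proof.
move=> p q; rewrite (polyV_evalw (msuppD_le p q)).
rewrite (polyV_evalw (fsubsetUl (msupp p) (msupp q))).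
rewrite (polyV_evalw (fsubsetUr (msupp p) (msupp q))).
by rewrite -big_split; apply: eq_bigr => k _; rewrite mcoeffD mulrDl.
Qed.

Lemma polyV_eval0 : polyV_eval 0 = 0.
Proof. by rewrite /polyV_eval msupp0 big_seq_fset0. Qed.

Lemma polyV_evalB : {morph polyV_eval : p q / p - q}.
Proof.
by move=> p q; apply/eqP; rewrite eq_sym subr_eq -polyV_evalD subrK.
Qed.

Lemma polyV_evalU k c : polyV_eval (mkmalgU k c) = c * monom_eval k.
Proof. by rewrite (polyV_evalw msuppU_le) big_seq_fset1 mcoeffUU. Qed.

(** Both sides are additive in each argument, which reduces the claim to single terms. *)
Lemma polyV_evalM : {morph polyV_eval : p q / p * q}.
Proof.
move=> p q; elim/polyV_ind: p => [|p1 p2 IH1 IH2|k a].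
- by rewrite mul0r polyV_eval0 mul0r.
- by rewrite mulrDl !polyV_evalD IH1 IH2 mulrDl.
elim/polyV_ind: q => [|q1 q2 IH1 IH2|l b].
- by rewrite mulr0 polyV_eval0 mulr0.
- by rewrite mulrDr !polyV_evalD IH1 IH2 mulrDr.
rewrite -[_ * _ in LHS]/(polyV_mul _ _) polyV_mulUU !polyV_evalU.
by rewrite monom_evalD mulrACA.
Qed.

Lemma polyV_evalC c : polyV_eval (polyV_C V c) = c.
Proof. by rewrite polyV_evalU monom_eval0 mulr1. Qed.

Lemma polyV_evalX v : polyV_eval (polyV_X R v) = r v.
Proof. by rewrite polyV_evalU mul1r; exact: (exponent_eval_unit r). Qed.

(** A generator evaluates to the product of [r] over a nonface, which is 0, the absorbing element of
    [mulBinoid R]. *)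
Lemma polyV_eval_ideal p : p \in @SR_ideal R V D -> polyV_eval p = 0.
Proof.
case/boolp.asboolP => c ->; rewrite (big_morph _ polyV_evalD polyV_eval0).
apply: big1 => A AD; rewrite polyV_evalM.
rewrite (big_morph _ polyV_evalM (polyV_evalC 1)).
rewrite (eq_bigr (r : V -> R)) => [|v _]; last exact: polyV_evalX.
by rewrite [\prod_(v in A) _](npointP r AD) mulr0.
Qed.

Definition SR_eval (x : SR) : R := polyV_eval (repr x).

Lemma SR_eval_pi p : SR_eval (\pi_SR p) = polyV_eval p.
Proof.
apply/eqP; rewrite -subr_eq0 -polyV_evalB polyV_eval_ideal //.
by rewrite Quotient.idealrBE reprK.
Qed.

Lemma SR_eval_zmod : zmod_morphism SR_eval.
Proof.
by move=> x y; rewrite -[x]reprK -[y]reprK -pi_SRB !SR_eval_pi polyV_evalB.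
Qed.

Lemma SR_eval_monoid : monoid_morphism SR_eval.
Proof.
split=> [|x y].
  by rewrite -pi_SR1 SR_eval_pi; exact: polyV_evalC.
by rewrite -[x]reprK -[y]reprK -pi_SRM !SR_eval_pi polyV_evalM.
Qed.

Lemma SR_eval_C c : SR_eval (SR_C D c) = c.
Proof. by rewrite SR_eval_pi polyV_evalC. Qed.

Definition SR_eval_algHom : SR_algHom R D :=
  SRAlgHom SR_eval_zmod SR_eval_monoid SR_eval_C.

Lemma SR_eval_X v : SR_eval (SR_X R D v) = r v.
Proof. by rewrite SR_eval_pi polyV_evalX. Qed.

End PolyEval.

Lemma SR_X_nonface (A : {set V}) :
  A \notin D -> \prod_(v in A) SR_X R D v = 0.
Proof.
move=> AD; rewrite -(big_morph _ pi_SRM pi_SR1) -pi_SR0.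
apply/eqP; rewrite -Quotient.idealrBE subr0; apply/boolp.asboolP.
(* The product is itself the generator attached to [A], so only that coefficient is nonzero. *)
exists (fun B => if B == A then 1 else 0).
rewrite (bigD1 A) //= eqxx mul1r [X in _ + X]big1 ?addr0 // => B /andP[_ /negPf ->].
by rewrite mul0r.
Qed.

(** * The point attached to an algebra homomorphism *)

Section AlgHom.
Variable phi : SR_algHom R D.

Lemma SR_algHomB : {morph phi : x y / x - y}.
Proof. exact: SR_algHom_zmod. Qed.

Lemma SR_algHom1 : phi 1 = 1.
Proof. by case: (SR_algHom_monoid phi). Qed.

Lemma SR_algHomM : {morph phi : x y / x * y}.
Proof. by case: (SR_algHom_monoid phi). Qed.

Lemma SR_algHom0 : phi 0 = 0.
Proof. by rewrite -(subrr 0) SR_algHomB subrr. Qed.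

Lemma SR_algHomD : {morph phi : x y / x + y}.
Proof.
(* [zmod_morphism] speaks of differences only, so the sum is written as [x - (0 - y)]. *)
by move=> x y; rewrite -{1}[y]opprK SR_algHomB -[- y]sub0r SR_algHomB SR_algHom0 sub0r opprK.
Qed.

Lemma SR_algHom_npointP (A : {set V}) :
  A \notin D ->
  \sum_(v in A) (phi (SR_X R D v) : mulBinoid R) = infty.
Proof.
move=> AD; transitivity (\prod_(v in A) phi (SR_X R D v)) => //.
by rewrite -(big_morph _ SR_algHomM SR_algHom1) SR_X_nonface // SR_algHom0.
Qed.

Definition SR_algHom_npoint : Npoint (mulBinoid R) D :=
  NPoint SR_algHom_npointP.

Lemma SR_algHomU k c :
  phi (\pi_SR (mkmalgU k c : P)) = c * monom_eval SR_algHom_npoint k.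
Proof.
have -> : mkmalgU k c = polyV_C V c * (mkmalgU k 1 : P).
  by rewrite -[RHS]/(polyV_mul _ _) polyV_mulUU add0r mulr1.
rewrite pi_SRM SR_algHomM SR_algHom_C; congr (_ * _).
(* With the scalar split off, [phi] on monic monomials is a monoid morphism from exponents to
   [mulBinoid R], hence fixed by the variables. *)
pose g (l : K) : mulBinoid R := phi (\pi_SR (mkmalgU l 1 : P)).
apply: (exponent_morphE (f := g)) => [|{}k l].
  by rewrite /g -[mkmalgU 0 1]/(1 : P) pi_SR1 SR_algHom1.
rewrite /g -[RHS]/(phi _ * phi _) -SR_algHomM -pi_SRM.
by rewrite -[_ * _ in RHS]/(polyV_mul _ _) polyV_mulUU mulr1.
Qed.

End AlgHom.

Lemma SR_algHom_eq (phi psi : SR_algHom R D) : phi =1 psi -> phi = psi.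
Proof.
case: phi psi => [f fB fM fC] [g gB gM gC] /= /boolp.funext E.
by case: _ / E gB gM gC => gB gM gC; congr SRAlgHom; exact: boolp.Prop_irrelevance.
Qed.

(** A polynomial is a sum of terms, and the value on a term depends on the homomorphism only through
    its point. *)
Lemma SR_algHom_inj (phi psi : SR_algHom R D) :
  phi \o SR_X R D =1 psi \o SR_X R D -> phi = psi.
Proof.
move=> E; have {}E : SR_algHom_npoint phi = SR_algHom_npoint psi.
  exact: Npoint_eq.
apply: SR_algHom_eq => x; rewrite -[x]reprK.
elim/polyV_ind: (repr x) => [|p q IHp IHq|k c].
- by rewrite pi_SR0 !SR_algHom0.
- by rewrite pi_SRD !SR_algHomD IHp IHq.
by rewrite !SR_algHomU E.
Qed.

Lemma SR_algHom_npoint_bij : bijective SR_algHom_npoint.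
Proof.
exists SR_eval_algHom => [phi|r]; last exact/Npoint_eq/SR_eval_X.
exact/SR_algHom_inj/SR_eval_X.
Qed.

End StanleyReisnerPoints.

Theorem proposition6p5p16 (V : finType) (D : simplicial_complex V)
    (N : comBinoidType) :
  (forall rho : Npoint N D,
     exists! rho' : binoid_hom (simplicialBinoid D) N,
       rho' \o simplicial_iota D =1 rho)
  /\ (exists F : semibinoid_iso (specM N D) (Npoint N D),
        forall f : specM N D, F f =1 f \o simplicial_iota D)
  /\ (forall R : comPzRingType,
        exists F : SR_algHom R D -> Npoint (mulBinoid R) D,
          bijective F
          /\ forall phi : SR_algHom R D, F phi =1 phi \o SR_X R D).
Proof.
split=> [rho|]; last split=> [|R].
- exists (npoint_ext rho); split=> [|f fE]; first exact: npoint_ext_iota.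
  by apply: specM_inj => v; rewrite npoint_ext_iota fE.
- by exists (specM_npoint_iso N D).
exists (@SR_algHom_npoint R V D); split=> //; exact: SR_algHom_npoint_bij.
Qed.
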